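(* Let $\alpha$ be an infinite word over the alphabet $\{0,1,2,3\}$ containing infinitely many non-zero letters. Then $\mathcal{G}^\alpha$ is a hereditary class of graphs of unbounded clique-width, i.e. for every $N$ there is a graph in $\mathcal{G}^\alpha$ of clique-width greater than $N$.
   Context: For an infinite word $\alpha=\alpha_1\alpha_2\cdots$ over $\{0,1,2,3\}$, the infinite graph $\mathcal{P}^\alpha$ has vertex set $\{v_{i,j}: i,j\in\mathbb{N}\}$ ($i$ is the row, $j$ the column; the column $C_j=\{v_{i,j}:i\in\mathbb{N}\}$). The only edges are between consecutive columns $C_j$ and $C_{j+1}$, determined by $\alpha_j$: if $\alpha_j=0$, $v_{i,j}v_{k,j+1}$ is an edge iff $i=k$; if $\alpha_j=1$, iff $i\neq k$; if $\alpha_j=2$, iff $i\le k$; if $\alpha_j=3$, iff $i\ge k$. $\mathcal{G}^\alpha$ denotes the class of all finite graphs isomorphic to induced subgraphs of $\mathcal{P}^\alpha$. Clique-width is the usual graph parameter: the minimum number of labels needed to build the graph using creation of a labelled vertex, disjoint union, joining all vertices of label $i$ to all vertices of label $j$ ($i\ne j$), and relabelling $i\to j$. *)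

(* Defs.v *)
From mathcomp Require Import all_boot.

Set Implicit Arguments.
Unset Strict Implicit.
Unset Printing Implicit Defensive.

Record graph := Graph {
  vert :> Type;
  adj : rel vert;
  adj_sym : symmetric adj;
  adj_irr : irreflexive adj
}.

Record fin_graph := FinGraph {
  fvert : finType;
  fadj : rel fvert;
  fadj_sym : symmetric fadj;
  fadj_irr : irreflexive fadj
}.

Coercion graph_of_fin_graph (G : fin_graph) : graph :=
  Graph (@fadj_sym G) (@fadj_irr G).

Definition isomorphic (G H : graph) : Prop :=
  exists2 f : G -> H, bijective f & forall x y : G, adj (f x) (f y) = adj x y.

Section Induced.
Variables (G : graph) (S : pred G).

Definition induced_adj : rel {x : G | S x} := fun x y => adj (sval x) (sval y).

Lemma induced_adj_sym : symmetric induced_adj.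
Proof. by move=> x y; apply: adj_sym. Qed.

Lemma induced_adj_irr : irreflexive induced_adj.
Proof. by move=> x; apply: adj_irr. Qed.

Definition induced : graph := Graph induced_adj_sym induced_adj_irr.
End Induced.

(* Taking S to be everything, this includes closure under isomorphism. *)
Definition hereditary (C : fin_graph -> Prop) : Prop :=
  forall (G H : fin_graph) (S : pred G), C G -> isomorphic H (induced S) -> C H.

Definition letter_rel (a : 'I_4) (i k : nat) : bool :=
  match val a with
  | 0 => i == k
  | 1 => i != k
  | 2 => i <= k
  | _ => i >= k
  end.

(* Rows, columns and positions in the word are numbered from 0: the vertex
   (i, j) is v_{i+1,j+1}, and alpha j is the letter alpha_{j+1}, which governs
   the edges between the columns j and j.+1. *)
Section WordGraph.
Variable alpha : nat -> 'I_4.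

Definition word_arc (x y : nat * nat) : bool :=
  (y.2 == x.2.+1) && letter_rel (alpha x.2) x.1 y.1.

Definition word_adj : rel (nat * nat) :=
  fun x y => word_arc x y || word_arc y x.

Lemma word_adj_sym : symmetric word_adj.
Proof. by move=> x y; rewrite /word_adj orbC. Qed.

Lemma word_adj_irr : irreflexive word_adj.
Proof. by move=> x; rewrite /word_adj orbb /word_arc -[_ == _.+1]negbK neq_ltn ltnSn. Qed.

Definition word_graph : graph := Graph word_adj_sym word_adj_irr.

Definition word_class (G : fin_graph) : Prop :=
  exists S : pred word_graph, isomorphic G (induced S).
End WordGraph.

Inductive cwterm (k : nat) : Type :=
| Vertex of 'I_k
| Union of cwterm k & cwterm k
| Join (i j : 'I_k) of i != j & cwterm k
| Relabel of 'I_k & 'I_k & cwterm k.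

Record lgraph (k : nat) := LGraph {
  lg_graph :> graph;
  lg_label : lg_graph -> 'I_k
}.

Section Operations.
Variable k : nat.

Definition vertex_adj : rel unit := fun _ _ => false.

Lemma vertex_adj_sym : symmetric vertex_adj. Proof. by []. Qed.
Lemma vertex_adj_irr : irreflexive vertex_adj. Proof. by []. Qed.

Definition vertex_lgraph (i : 'I_k) : lgraph k :=
  @LGraph k (Graph vertex_adj_sym vertex_adj_irr) (fun=> i).

Section UnionGraph.
Variables G H : lgraph k.

Definition union_adj : rel (G + H) := fun x y =>
  match x, y with
  | inl u, inl v => adj u v
  | inr u, inr v => adj u v
  | _, _ => false
  end.

Lemma union_adj_sym : symmetric union_adj.
Proof. by move=> [u|u] [v|v] //=; apply: adj_sym. Qed.

Lemma union_adj_irr : irreflexive union_adj.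
Proof. by move=> [u|u]; apply: adj_irr. Qed.

Definition union_lgraph : lgraph k :=
  @LGraph k (Graph union_adj_sym union_adj_irr)
    (fun x => match x with inl u => lg_label u | inr v => lg_label v end).
End UnionGraph.

Section JoinGraph.
Variables (G : lgraph k) (i j : 'I_k) (neq_ij : i != j).

Definition join_adj : rel G := fun x y =>
  [|| adj x y,
      (lg_label x == i) && (lg_label y == j)
    | (lg_label x == j) && (lg_label y == i)].

Lemma join_adj_sym : symmetric join_adj.
Proof.
move=> x y; rewrite /join_adj adj_sym; congr (_ || _).
by rewrite orbC; congr (_ || _); rewrite andbC.
Qed.

Lemma join_adj_irr : irreflexive join_adj.
Proof.
move=> x; rewrite /join_adj adj_irr /= andbC orbb.
by apply/andP => -[/eqP xi /eqP xj]; case/eqP: neq_ij; rewrite -xi -xj.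
Qed.

Definition join_lgraph : lgraph k :=
  @LGraph k (Graph join_adj_sym join_adj_irr) (@lg_label k G).
End JoinGraph.

Definition relabel_lgraph (G : lgraph k) (i j : 'I_k) : lgraph k :=
  @LGraph k G (fun x => if lg_label x == i then j else lg_label x).

Fixpoint cwvalue (t : cwterm k) : lgraph k :=
  match t with
  | Vertex i => vertex_lgraph i
  | Union t1 t2 => union_lgraph (cwvalue t1) (cwvalue t2)
  | Join i j neq_ij t1 => join_lgraph (cwvalue t1) neq_ij
  | Relabel i j t1 => relabel_lgraph (cwvalue t1) i j
  end.
End Operations.

Definition cw_buildable (G : graph) (k : nat) : Prop :=
  exists t : cwterm k, isomorphic G (cwvalue t).

(* Every nonempty finite graph has exactly one clique-width in this sense; the
   graph with no vertex cannot be built and has none. *)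
Definition has_cliquewidth (G : graph) (k : nat) : Prop :=
  cw_buildable G k /\ forall m, cw_buildable G m -> k <= m.

(* Main.v *)
(** Take a finite grid of P^alpha with R rows, whose columns meet at least m
    nonzero letters.  A term with k labels building it yields a set A of
    vertices such that vertices of A with equal label have the same neighbours
    outside A, and A contains between one and two thirds of the cells lying in
    the columns followed by a nonzero letter.  Call j a cut column if some edge
    between the columns j and j+1 joins A to its complement.  Choosing one such
    edge for each cut column and keeping every third column gives an induced
    matching across the cut, hence there are at most 3k cut columns.  If j is
    not a cut column, then A does not distinguish the two ends of any row
    segment between the columns j and j+1, and if moreover alpha_j is nonzero,
    the bipartite graph between these columns is connected, so they are
    monochromatic.  When m > 9k the balance condition therefore gives a column
    inside A and another one outside A, so each of the R rows crosses the cut,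
    in the same direction, at some cut column.  The rows crossing at one given
    cut column have pairwise different neighbourhoods across the cut, so
    R <= 3k * k. *)

Require Import Defs.
From mathcomp Require Import all_boot.
From mathcomp Require Import zify.
From Stdlib Require Import Classical.

Set Implicit Arguments.
Unset Strict Implicit.
Unset Printing Implicit Defensive.

(** * Heredity of the class *)

Lemma inj_surj_bijective (T : finType) (U : eqType) (f : T -> U) :
  injective f -> (forall y, exists x, f x = y) -> bijective f.
Proof.
move=> injf surjf.
have ex y : exists x, f x == y by case: (surjf y) => x <-; exists x.
have fK y : f (xchoose (ex y)) = y by apply/eqP; apply: (xchooseP (ex y)).
by exists (fun y => xchoose (ex y)) => // x; apply: injf.
Qed.

Lemma word_class_hereditary (alpha : nat -> 'I_4) :
  hereditary (word_class alpha).
Proof.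
move=> G H S [S0 [f bijf fadj]] [g bijg gadj].
(* The image of the composite embedding of [H], made Boolean by quantifying over the finite vertex
   set of [G]. *)
pose T : pred (word_graph alpha) := fun x : nat * nat =>
  [exists v : fvert G, (sval (f v) == x :> nat * nat) && S v].
have Tg (h : fvert H) : T (sval (f (sval (g h)))).
  by apply/existsP; exists (sval (g h)); rewrite eqxx (svalP (g h)).
exists T.
exists (fun h : fvert H => exist (fun x => T x) _ (Tg h)); last first.
  by move=> x y; rewrite -gadj -[RHS]fadj.
apply: (@inj_surj_bijective (fvert H) {x : nat * nat | T x}).
  move=> h h' [] /val_inj /(bij_inj bijf) /val_inj; exact: (bij_inj bijg).
case=> x Tx; have /existsP[v /andP[/eqP fv Sv]] := Tx.
case: (bijg) => g' gK g'K.
exists (g' (exist _ v Sv)); apply: val_inj; rewrite /= g'K /=; exact: fv.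
Qed.

(** * Clique-width terms *)

Section Represent.
Variable G : fin_graph.
Let k := #|fvert G|.

(* [t] builds the graph with vertex set [s] and adjacency [R], every vertex [v]
   carrying its own label [enum_rank v]. *)
Definition represents (t : cwterm k) (s : seq (fvert G)) (R : rel (fvert G)) :=
  exists g : cwvalue t -> fvert G, exists f : fvert G -> cwvalue t,
  [/\ forall x, g x \in s, forall v, v \in s -> g (f v) = v, cancel g f,
      forall x, lg_label x = enum_rank (g x)
    & forall x y, adj x y = R (g x) (g y)].

Lemma represents_edgeless (v : fvert G) s : uniq (v :: s) ->
  exists t, represents t (v :: s) (fun _ _ => false).
Proof.
elim: s v => [|w s IHs] v.
  move=> _; exists (Vertex (enum_rank v)), (fun=> v), (fun=> tt); split=> //.
  - by move=> _; rewrite inE.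
  - by move=> u; rewrite inE => /eqP.
  - by case.
move=> /andP[vNs /IHs[t [g [f [gs fK gK glab gadj]]]]].
exists (Union (Vertex (enum_rank v)) t).
exists (fun x => match x with inl _ => v | inr y => g y end).
exists (fun u => if u == v then inl tt else inr (f u)); split.
- by case=> [_|y]; rewrite inE ?eqxx // gs orbT.
- move=> u; rewrite inE; case: eqP => [-> //|_ /=]; exact: fK.
- case=> [[]|y]; first by rewrite eqxx.
  by case: eqP => [gy|_]; [rewrite -gy gs in vNs | rewrite gK].
- by case=> [|y] //=.
- by case=> [u|u] [u'|u'] //=.
Qed.

(** Labels of distinct vertices differ, so each join of two labels adds the single edge between
    their two vertices. *)
Lemma represents_edges (t : cwterm k) s R (es : seq (fvert G * fvert G)) :
    all (fun e => e.1 != e.2) es -> represents t s R ->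
  exists t', represents t' s (fun u v =>
     [|| R u v, (u, v) \in es | (v, u) \in es]).
Proof.
elim: es => [_ rt|[a b] es IHes /= /andP[nab /IHes{}IHes] /IHes[t' rt']].
  exists t; case: rt => g [f [gs fK gK glab gadj]]; exists g, f; split=> //.
  by move=> x y; rewrite gadj !orbF.
have nab' : enum_rank a != enum_rank b by rewrite (inj_eq enum_rank_inj).
exists (Join nab' t').
case: rt' => g [f [gs fK gK glab gadj]]; exists g, f; split=> //.
move=> x y /=; rewrite /join_adj gadj !glab !(inj_eq enum_rank_inj) !inE !xpair_eqE.
case: (R _ _) => //=; case: ((_, _) \in es); case: ((_, _) \in es);
  by case: (g x == a); case: (g x == b); case: (g y == a); case: (g y == b).
Qed.

Lemma cw_buildable_card (v : fvert G) : cw_buildable G k.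
Proof.
have [s vs us] : exists2 s, (forall u, u \in v :: s) & uniq (v :: s).
  exists (rem v (enum (fvert G))).
    by move=> u; rewrite inE mem_rem_uniq ?enum_uniq // !inE mem_enum andbT orbN.
  by rewrite /= rem_uniq ?enum_uniq // mem_rem_uniq ?enum_uniq // !inE eqxx.
have [t0 rt0] := represents_edgeless us.
pose es := [seq e <- enum {: fvert G * fvert G} | @fadj G e.1 e.2].
have es_irr : all (fun e => e.1 != e.2) es.
  apply/allP => -[a b]; rewrite mem_filter => /andP[/= ab _].
  by apply: contraTneq ab => ->; rewrite fadj_irr.
have [t [g [f [gs fK gK glab gadj]]]] := represents_edges es_irr rt0.
have esE a b : ((a, b) \in es) = @fadj G a b.
  by rewrite mem_filter mem_enum andbT.
exists t; exists f.
  by exists g => // u; apply: fK.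
by move=> x y; rewrite gadj !fK // !esE /= [X in _ || X]fadj_sym orbb.
Qed.

End Represent.

(** Buildability is only a proposition, so the least number of labels is found classically: if none
    were least, induction would exclude every number, against [cw_buildable_card]. *)
Lemma has_cliquewidth_ex (G : fin_graph) (v : fvert G) :
  exists k, has_cliquewidth G k.
Proof.
apply: NNPP => noG.
suff nobuild m : forall k, k < m -> ~ cw_buildable G k.
  exact: (nobuild _ _ (ltnSn _) (cw_buildable_card v)).
elim: m => // m IHm k; rewrite ltnS leq_eqVlt => /predU1P[->|/IHm//] Gm.
apply: noG; exists m; split=> // j Gj; case: (leqP m j) => // /IHm; exact.
Qed.

(** * Balanced cuts from terms *)

Section BalancedCut.
Variables (G : fin_graph) (k : nat) (W : {set fvert G}).
Hypothesis W_gt1 : 1 < #|W|.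

Lemma cut_of_partial_map (H : lgraph k) (g : fvert G -> option H) :
    (forall u v w x y, g u = Some x -> g v = Some y ->
       lg_label x = lg_label y -> g w = None -> @fadj G u w = @fadj G v w) ->
    #|W| < 3 * #|[set u in W | isSome (g u)]| ->
    3 * #|[set u in W | isSome (g u)]| <= 2 * #|W| ->
  exists (A : {set fvert G}) (lab : fvert G -> 'I_k),
    [/\ {in A & A, forall u v w, w \notin A -> lab u = lab v ->
           @fadj G u w = @fadj G v w},
        #|W| < 3 * #|W :&: A| & 3 * #|W :&: A| <= 2 * #|W|].
Proof.
move=> gout big small.
(* Some vertex is built; its label serves as the default outside the set. *)
have /card_gt0P[u0] : 0 < #|[set u in W | isSome (g u)]| by lia.
rewrite inE => /andP[_]; case gu0: (g u0) => [x0|//] _.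
exists [set u | isSome (g u)].
exists (fun u => if g u is Some x then lg_label x else lg_label x0).
have -> : W :&: [set u | isSome (g u)] = [set u in W | isSome (g u)].
  by apply/setP => u; rewrite !inE.
split=> // u v; rewrite !inE.
case gu: (g u) => [x|//] _; case gv: (g v) => [y|//] _ w.
rewrite inE; case gw: (g w) => [//|] _ xy.
exact: (gout _ _ _ _ _ gu gv).
Qed.

(* The partial map [g] locates the vertices of [G] built by the subterm [t];
   [L] collects the label pairs joined above [t]. *)
Lemma subterm_balanced_cut (t : cwterm k) (g : fvert G -> option (cwvalue t))
    (L : rel 'I_k) :
    (forall u v x, g u = Some x -> g v = Some x -> u = v) ->
    (forall u v x y, g u = Some x -> g v = Some y ->
       @fadj G u v = adj x y || L (lg_label x) (lg_label y)) ->
    (forall u v w x y, g u = Some x -> g v = Some y ->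
       lg_label x = lg_label y -> g w = None -> @fadj G u w = @fadj G v w) ->
    #|W| < 3 * #|[set u in W | isSome (g u)]| ->
  exists (A : {set fvert G}) (lab : fvert G -> 'I_k),
    [/\ {in A & A, forall u v w, w \notin A -> lab u = lab v ->
           @fadj G u w = @fadj G v w},
        #|W| < 3 * #|W :&: A| & 3 * #|W :&: A| <= 2 * #|W|].
Proof.
(* Descend into the term and stop at the first subterm holding at most two thirds of [W]. *)
elim: t g L => [i|t1 IH1 t2 IH2|i j nij t IH|i j t IH] g L ginj gadj gout big;
  (case: (leqP (3 * #|[set u in W | isSome (g u)]|) (2 * #|W|)) => [small|large];
   first exact: (cut_of_partial_map gout)).
(* One vertex cannot exceed two thirds of [W], since [1 < #|W|]. *)
- have : #|[set u in W | isSome (g u)]| <= 1.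
    apply/card_le1_eqP => u v; rewrite !inE => /andP[_ gu] /andP[_ gv].
    case eu: (g u) gu => [[]|//] _; case ev: (g v) gv => [[]|//] _.
    exact: (ginj _ _ tt).
  lia.
- pose g1 u := if g u is Some (inl x) then Some x else None.
  pose g2 u := if g u is Some (inr x) then Some x else None.
  have g1E u x : g1 u = Some x -> g u = Some (inl x).
    by rewrite /g1; case: (g u) => [[y|y]|] // [->].
  have g2E u x : g2 u = Some x -> g u = Some (inr x).
    by rewrite /g2; case: (g u) => [[y|y]|] // [->].
  have : #|[set u in W | isSome (g u)]| <=
         #|[set u in W | isSome (g1 u)]| + #|[set u in W | isSome (g2 u)]|.
    apply: leq_trans (leq_card_setU _ _); apply: subset_leq_card.
    apply/subsetP => u; rewrite !inE /g1 /g2.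
    by case: (g u) => [[y|y]|]; rewrite ?andbT ?andbF ?orbF.
  move=> le12.
  (* More than two thirds is split in two, so one operand keeps more than one third. *)
  have [big1|big2] : #|W| < 3 * #|[set u in W | isSome (g1 u)]| \/
                     #|W| < 3 * #|[set u in W | isSome (g2 u)]| by lia.
  + apply: (IH1 g1 L) => //.
    * by move=> u v x /g1E gu /g1E gv; apply: ginj gu gv.
    * by move=> u v x y /g1E gu /g1E gv; apply: (gadj _ _ _ _ gu gv).
    * move=> u v w x y /g1E gu /g1E gv xy; rewrite /g1.
      (* If [w] lies in the other operand, the union has no edge to it; its adjacencies come from
         [L], which sees labels only. *)
      case gw: (g w) => [[z|z]|] // _; last exact: (gout _ _ _ _ _ gu gv).
      by rewrite (gadj _ _ _ _ gu gw) (gadj _ _ _ _ gv gw) /= xy.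
  + apply: (IH2 g2 L) => //.
    * by move=> u v x /g2E gu /g2E gv; apply: ginj gu gv.
    * by move=> u v x y /g2E gu /g2E gv; apply: (gadj _ _ _ _ gu gv).
    * move=> u v w x y /g2E gu /g2E gv xy; rewrite /g2.
      case gw: (g w) => [[z|z]|] // _; last exact: (gout _ _ _ _ _ gu gv).
      by rewrite (gadj _ _ _ _ gu gw) (gadj _ _ _ _ gv gw) /= xy.
- apply: (IH g (fun a b => [|| (a == i) && (b == j), (a == j) && (b == i)
                             | L a b])) => //.
  by move=> u v x y gu gv; rewrite (gadj _ _ _ _ gu gv) /= /join_adj -!orbA.
- pose r a := if a == i then j else a.
  apply: (IH g (fun a b => L (r a) (r b))) => //.
  move=> u v w x y gu gv xy; apply: (gout _ _ _ _ _ gu gv) => /=.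
  by rewrite xy.
Qed.

Lemma cw_buildable_balanced_cut : cw_buildable G k ->
  exists (A : {set fvert G}) (lab : fvert G -> 'I_k),
    [/\ {in A & A, forall u v w, w \notin A -> lab u = lab v ->
           @fadj G u w = @fadj G v w},
        #|W| < 3 * #|W :&: A| & 3 * #|W :&: A| <= 2 * #|W|].
Proof.
move=> [t [f bijf fE]].
apply: (@subterm_balanced_cut t (fun u => Some (f u)) (fun _ _ => false)) => //.
- by move=> u v x [<-] [/(bij_inj bijf)].
- by move=> u v x y [<-] [<-]; rewrite orbF fE.
- have -> : [set u in W | isSome (Some (f u))] = W.
    by apply/setP => u; rewrite inE andbT.
  lia.
Qed.

End BalancedCut.

(** * Cuts of a grid *)

(** When two rows cross the cut, their own far ends are known to lie outside [a]; testing at [i] and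
    [i'] alone is therefore enough for the later count. *)
Lemma letter_rel_row_inj a i i' :
  letter_rel a i i = letter_rel a i' i ->
  letter_rel a i i' = letter_rel a i' i' -> i = i'.
Proof. by rewrite /letter_rel; case: (val a) => [|[|[|?]]]; lia. Qed.

Lemma letter_rel_col_inj a i i' :
  letter_rel a i i = letter_rel a i i' ->
  letter_rel a i' i = letter_rel a i' i' -> i = i'.
Proof. by rewrite /letter_rel; case: (val a) => [|[|[|?]]]; lia. Qed.

Lemma word_adj_succ alpha i i' j :
  word_adj alpha (i, j) (i', j.+1) = letter_rel (alpha j) i i'.
Proof. by rewrite /word_adj /word_arc /= eqxx; case: letter_rel; lia. Qed.

Lemma word_adj_col alpha x y :
  word_adj alpha x y -> (x.2 == y.2.+1) || (y.2 == x.2.+1).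
Proof. by case/orP => /andP[-> _]; rewrite ?orbT. Qed.

Lemma exists_change (P : pred nat) p q : p <= q -> P p -> ~~ P q ->
  exists2 j, p <= j < q & P j && ~~ P j.+1.
Proof.
elim: q => [|q IHq]; first by rewrite leqn0 => /eqP-> ->.
rewrite leq_eqVlt => /predU1P[-> ->//|]; rewrite ltnS => pq Pp nPq.
case: (boolP (P q)) => Pq; first by exists q; rewrite ?Pq ?nPq; lia.
by have [j jpq Pj] := IHq pq Pp Pq; exists j => //; lia.
Qed.

Section GridCut.
Variables (alpha : nat -> 'I_4) (n M k : nat).
Variables (a : pred (nat * nat)) (lab : nat * nat -> 'I_k).

Definition in_grid (x : nat * nat) := (x.1 < n) && (x.2 <= M).

Hypothesis cut_lab : forall x y z, in_grid x -> in_grid y -> in_grid z ->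
  a x -> a y -> ~~ a z -> lab x = lab y -> word_adj alpha x z = word_adj alpha y z.

Definition cut_column (j : nat) := [exists i : 'I_n, exists i' : 'I_n,
  letter_rel (alpha j) i i' && (a (i : nat, j) != a (i' : nat, j.+1))].

Lemma cut_columns_card : #|[set j : 'I_M | cut_column j]| <= 3 * k.
Proof.
have /fin_all_exists[e eP] (j : 'I_M) : exists e : (nat * nat) * (nat * nat),
    cut_column j ->
    [/\ in_grid e.1, in_grid e.2, a e.1, ~~ a e.2 & word_adj alpha e.1 e.2]
    /\ (j <= e.1.2 <= j.+1 /\ j <= e.2.2 <= j.+1).
  case: (boolP (cut_column j)) => [|_]; last by exists ((0, 0), (0, 0)).
  case/existsP => i /existsP[i' /andP[ii' ne]].
  have ltj := ltn_ord j; have lti := ltn_ord i; have lti' := ltn_ord i'.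
  case aij: (a (i : nat, j : nat)) ne => ne.
    exists ((i : nat, j : nat), (i' : nat, j.+1)) => _.
    rewrite /in_grid word_adj_succ /=; split; last by lia.
    by split=> //; lia.
  exists ((i' : nat, j.+1), (i : nat, j : nat)) => _.
  rewrite /in_grid word_adj_sym word_adj_succ /= aij; split; last by lia.
  by split=> //; lia.
(* The label of the end inside [a], and the column modulo 3; the pair takes at most [3 * k]
   values. *)
pose F (j : 'I_M) := (lab (e j).1, inord (j %% 3) : 'I_3).
have Finj : {in [set j : 'I_M | cut_column j] &, injective F}.
  move=> j j'; rewrite !inE => /eP[[g1 g2 a1 a2 adj12] [c1 c2]].
  move=> /eP[[g1' g2' a1' a2' adj12'] [c1' c2']] [elab emod].
  have em : j %% 3 = j' %% 3.
    have := congr1 (@nat_of_ord 3) emod.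
    by rewrite !inordK ?ltn_pmod.
  (* Equal labels make the inner end chosen for [j'] adjacent to the outer end chosen for [j]. So
     [j] and [j'] differ by at most 2, and being congruent modulo 3 they coincide. *)
  have := cut_lab g1' g1 g2 a1' a1 a2 (esym elab).
  rewrite adj12 => /word_adj_col => col.
  by apply: val_inj => /=; lia.
rewrite -(card_in_imset Finj); apply: leq_trans (max_card _) _.
by rewrite card_prod !card_ord mulnC.
Qed.

Hypothesis n_gt2 : 2 < n.

Lemma uncut_edge i i' j : i < n -> i' < n -> ~~ cut_column j ->
  letter_rel (alpha j) i i' -> a (i, j) = a (i', j.+1).
Proof.
move=> lti lti' ncut ii'; apply/eqP; apply: contraNT ncut => ne.
by apply/existsP; exists (Ordinal lti); apply/existsP; exists (Ordinal lti');
  rewrite /= ii' ne.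
Qed.

(* A nonzero letter induces a connected bipartite graph on three or more rows. *)
Lemma uncut_column_const i i' j : i < n -> i' < n -> ~~ cut_column j ->
  alpha j != ord0 -> a (i, j) = a (i', j).
Proof.
move=> lti lti' ncut nz; have E := uncut_edge _ _ ncut.
move: nz E; rewrite -val_eqE /letter_rel /=; case: (val (alpha j)) => [//|[|[|l]]] _ E.
(* Letter 1: a third row gives a common neighbour of both vertices in the next column. *)
- have [l [ltl li li']] : exists l, [/\ l < n, i != l & i' != l].
    by case: (boolP ((i != 0) && (i' != 0)));
      [exists 0 | case: (boolP ((i != 1) && (i' != 1))); [exists 1 | exists 2]]; split; lia.
  by rewrite (E i l) // (E i' l).
(* Letters 2 and 3: the last row, respectively row 0, of the next column is a common neighbour. *)
- by rewrite (E i n.-1) ?(E i' n.-1) //; lia.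
- by rewrite (E i 0) ?(E i' 0) //; lia.
Qed.

Lemma uncut_row_step i j : i < n -> ~~ cut_column j ->
  a (i, j) = a (i, j.+1).
Proof.
move=> lti ncut; case: (boolP (letter_rel (alpha j) i i)) => [|nii].
  exact: uncut_edge.
have nz : alpha j != ord0.
  by apply: contraNneq nii => ->; rewrite /letter_rel /=.
(* Only letter 1 lacks the horizontal edge; column [j] is then constant, and any other row [l] of it
   is adjacent to [(i, j.+1)]. *)
have [l ltl li] : exists2 l, l < n & l != i.
  by case: (posnP i) => [->|?]; [exists 1 | exists 0]; lia.
rewrite (uncut_column_const lti ltl ncut nz); apply: uncut_edge => //.
by move: nii; rewrite /letter_rel; case: (val (alpha j)) => [|[|[|?]]] //; lia.
Qed.

Lemma rows_crossing_card (d : bool) :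
    (forall i : 'I_n, exists j : 'I_M,
       a (i : nat, j : nat) = d /\ a (i : nat, j.+1) = ~~ d) ->
  n <= 3 * k * k.
Proof.
move=> /fin_all_exists[c cP].
(* The end of the crossing that lies inside [a]. *)
pose x (i : 'I_n) := (i : nat, if d then c i : nat else (c i).+1).
pose F i := (c i, lab (x i)).
have Finj : injective F.
  move=> i i' [ec elab]; apply: val_inj => /=.
  have [p q] := cP i; have [p' q'] := cP i'.
  have lti := ltn_ord i; have lti' := ltn_ord i'; have ltj := ltn_ord (c i).
  move: elab p' q'; rewrite /x -{}ec {x F cP}.
  case: d p q => p q elab p' q'.
  - have H (l : 'I_n) : ~~ a (l : nat, (c i).+1) ->
        letter_rel (alpha (c i)) i l = letter_rel (alpha (c i)) i' l.
      move=> al; have ltl := ltn_ord l; rewrite -!word_adj_succ.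
      by apply: cut_lab; rewrite ?p ?p' ?al // /in_grid /=; lia.
    by apply: letter_rel_row_inj; apply: H; rewrite ?q ?q'.
  - have H (l : 'I_n) : ~~ a (l : nat, c i : nat) ->
        letter_rel (alpha (c i)) l i = letter_rel (alpha (c i)) l i'.
      move=> al; have ltl := ltn_ord l; rewrite -!word_adj_succ.
      rewrite ![word_adj _ (l : nat, _) _]word_adj_sym.
      by apply: cut_lab; rewrite ?q ?q' ?al // /in_grid /=; lia.
    by apply: letter_rel_col_inj; apply: H; rewrite ?p ?p'.
(* By [uncut_row_step] a row can cross only at a cut column, which bounds the first component of
   [F]. *)
have sub : F @: [set: 'I_n] \subset
    setX [set j : 'I_M | cut_column j] [set: 'I_k].
  apply/subsetP => _ /imsetP[i _ ->]; rewrite !inE andbT /=.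
  case: (boolP (cut_column _)) => // ncut; have [] := cP i.
  by rewrite (uncut_row_step (ltn_ord i) ncut) => ->; case: (d).
have := subset_leq_card sub.
rewrite card_imset // cardsX !cardsT !card_ord => /leq_trans; apply.
by rewrite leq_mul2r cut_columns_card orbT.
Qed.

Lemma columns_bichromatic_rows p q : p <= M -> q <= M ->
    (forall i, i < n -> a (i, p)) -> (forall i, i < n -> ~~ a (i, q)) ->
  n <= 3 * k * k.
Proof.
move=> pM qM ap aq; case: (leqP p q) => pq.
  apply: (@rows_crossing_card true) => i.
  have [j jpq /andP[aj aj1]] := @exists_change (fun j => a (i : nat, j)) _ _ pq
    (ap _ (ltn_ord i)) (aq _ (ltn_ord i)).
  have jM : j < M by lia.
  by exists (Ordinal jM); rewrite /= aj (negPf aj1).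
(* With [q] on the left, the change is sought for the complement of [a]. *)
apply: (@rows_crossing_card false) => i.
have nap : ~~ ~~ a (i : nat, p) by rewrite negbK ap.
have [j jpq /andP[aj aj1]] := @exists_change (fun j => ~~ a (i : nat, j)) _ _
  (ltnW pq) (aq _ (ltn_ord i)) nap.
have jM : j < M by lia.
by exists (Ordinal jM); rewrite /= (negPf aj) (negbNE aj1).
Qed.

End GridCut.

(** * Finite grids of a word graph *)

Section Grid.
Variables (alpha : nat -> 'I_4) (n M : nat).

Definition cell (u : 'I_n.+1 * 'I_M.+1) : nat * nat := (u.1 : nat, u.2 : nat).

Definition grid_adj : rel ('I_n.+1 * 'I_M.+1) :=
  fun u v => word_adj alpha (cell u) (cell v).

Lemma grid_adj_sym : symmetric grid_adj.
Proof. by move=> u v; apply: word_adj_sym. Qed.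

Lemma grid_adj_irr : irreflexive grid_adj.
Proof. by move=> u; apply: word_adj_irr. Qed.

Definition grid_graph : fin_graph := FinGraph grid_adj_sym grid_adj_irr.

Lemma word_class_grid : word_class alpha grid_graph.
Proof.
pose S : pred (word_graph alpha) := fun x : nat * nat =>
  (x.1 < n.+1) && (x.2 < M.+1).
have Sc u : S (cell u) by rewrite /S /= !ltn_ord.
exists S; exists (fun u => exist (fun x => S x) _ (Sc u)) => //.
apply: (@inj_surj_bijective _ {x : nat * nat | S x}).
  by move=> [i j] [i' j'] [] /val_inj-> /val_inj->.
case=> -[i j] Sij; have /andP[/= lti ltj] := Sij.
by exists (Ordinal lti, Ordinal ltj); apply: val_inj.
Qed.

Definition nonzero_columns := [set j : 'I_M | alpha j != ord0].

Lemma grid_not_buildable k : 1 < n -> 9 * k < #|nonzero_columns| ->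
  3 * k * k <= n -> ~ cw_buildable grid_graph k.
Proof.
move=> n_gt1 manycols manyrows build.
pose up (j : 'I_M) : 'I_M.+1 := widen_ord (leqnSn M) j.
pose emb (u : 'I_n.+1 * 'I_M) := (u.1, up u.2).
have emb_inj : injective emb.
  by move=> [i j] [i' j'] [-> /val_inj->].
pose W := emb @: setX [set: 'I_n.+1] nonzero_columns.
have cardW : #|W| = n.+1 * #|nonzero_columns|.
  by rewrite card_imset // cardsX cardsT card_ord.
have W_gt1 : 1 < #|W| by rewrite cardW; nia.
have [A [lab [cutA bigA smallA]]] :=
  @cw_buildable_balanced_cut grid_graph k W W_gt1 build.
(* Inverse to [cell] on the grid; coordinates out of range get the default 0, and [a] is evaluated
   only inside the grid. *)
pose E (x : nat * nat) : 'I_n.+1 * 'I_M.+1 := (inord x.1, inord x.2).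
have EK x : in_grid n.+1 M x -> cell (E x) = x.
  by case: x => i j /andP[/= lti lej]; rewrite /cell /= !inordK.
have cE u : E (cell u) = u by case: u => i j; rewrite /E /cell /= !inord_val.
pose a : pred (nat * nat) := fun x => E x \in A.
have cut_lab x y z : in_grid n.+1 M x -> in_grid n.+1 M y -> in_grid n.+1 M z ->
    a x -> a y -> ~~ a z -> lab (E x) = lab (E y) ->
    word_adj alpha x z = word_adj alpha y z.
  move=> gx gy gz ax ay az elab.
  by have := cutA _ _ ax ay _ az elab; rewrite /= /grid_adj !EK.
pose cuts := [set j : 'I_M | cut_column alpha n.+1 a j].
have cuts_le : #|cuts| <= 3 * k := cut_columns_card cut_lab.
have uncut_col (B : {set 'I_n.+1 * 'I_M.+1}) : B \subset W -> #|W| <= 3 * #|B| ->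
    exists i : 'I_n.+1, exists j : 'I_M,
    [/\ (i, up j) \in B, alpha j != ord0 & ~~ cut_column alpha n.+1 a j].
  move=> BW bigB.
  (* The cut columns hold at most [3 * k * n.+1] cells, less than a third of [W]; this is where
     [9 * k] comes from. *)
  have nsub : ~~ (B \subset emb @: setX [set: 'I_n.+1] cuts).
    apply/negP => /subset_leq_card; rewrite card_imset // cardsX cardsT card_ord.
    by move: bigB; rewrite cardW; nia.
  have /subsetPn[u uB uNcut] := nsub.
  have /imsetP[[i j]] := subsetP BW _ uB; rewrite !inE /= => nz eu.
  exists i, j; split=> //; first by rewrite -/(emb (i, j)) -eu.
  apply: contra uNcut => cutj; rewrite eu; apply: imset_f.
  by rewrite !inE.
have colconst (i : 'I_n.+1) (j : 'I_M) i' : i' < n.+1 -> alpha j != ord0 ->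
    ~~ cut_column alpha n.+1 a j -> a (i', j : nat) = ((i, up j) \in A).
  move=> lti' nz ncut; rewrite -(cE (i, up j)).
  by apply: (@uncut_column_const alpha n.+1) => /=.
have [i [p [ipA nzp ncutp]]] := uncut_col _ (subsetIl W A) (ltnW bigA).
have bigD : #|W| <= 3 * #|W :\: A|.
  rewrite cardsD mulnBr; apply: leq_trans (leq_sub2l _ smallA).
  by rewrite -mulnBl mul1n.
have [i' [q [iqA nzq ncutq]]] := uncut_col _ (subsetDl W A) bigD.
suff : n.+1 <= 3 * k * k by lia.
apply: (@columns_bichromatic_rows alpha n.+1 M k a (lab \o E) cut_lab _ p q).
- by rewrite ltnS.
- exact/ltnW/ltn_ord.
- exact/ltnW/ltn_ord.
- move=> l ltl; rewrite (colconst i) //.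
  by move: ipA; rewrite inE => /andP[].
- move=> l ltl; rewrite (colconst i') //.
  by move: iqA; rewrite inE => /andP[].
Qed.

End Grid.

Lemma many_nonzero_columns (alpha : nat -> 'I_4) m :
  (forall n : nat, exists2 m : nat, n <= m & alpha m <> ord0) ->
  exists M, m <= #|nonzero_columns alpha M|.
Proof.
move=> inf.
(* As a sum over naturals, the count can be compared for different [M], although the sets live in
   different ordinal types. *)
have cardE M : #|nonzero_columns alpha M| = \sum_(0 <= j < M) (alpha j != ord0).
  by rewrite -sum1dep_card big_mkord [LHS]big_mkcond; apply: eq_bigr => j _; case: ifP.
elim: m => [|m [M lemM]]; first by exists 0.
have [j leMj /eqP nzj] := inf M; exists j.+1.
rewrite cardE big_nat_recr //= nzj addn1 ltnS; apply: (leq_trans lemM).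
by rewrite cardE (big_cat_nat (leq0n M) leMj) leq_addr.
Qed.

Theorem theorem3p10 (alpha : nat -> 'I_4)
  (alpha_inf : forall n : nat, exists2 m : nat, n <= m & alpha m <> ord0) :
  hereditary (word_class alpha) /\
  forall N : nat, exists (G : fin_graph) (n : nat),
    word_class alpha G /\ has_cliquewidth G n /\ N < n.
Proof.
split=> [|N]; first exact: word_class_hereditary.
have [M manycols] := many_nonzero_columns (9 * N).+1 alpha_inf.
(* This dominates [3 * k * k] for every [k <= N], and the added 2 ensures three rows even when
   [N = 0]. *)
pose n := (3 * N * N).+2.
have [k cwk] := @has_cliquewidth_ex (grid_graph alpha n M) (ord0, ord0).
exists (grid_graph alpha n M), k; split; first exact: word_class_grid.
split=> //; rewrite ltnNge; apply/negP => kN.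
case: cwk => build _.
apply: (@grid_not_buildable alpha n M k) build; rewrite /n.
- by [].
- by lia.
- by nia.
Qed.
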